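(* The cones $\Pi_E(\mathcal D)$ and $\mathcal D^*\cap\mathcal S(E)$ are dual cones (of each other) in the space $\mathcal S(E)$ equipped with the trace inner product.
   Context: All matrices are real symmetric of size $(n+1)\times(n+1)$ with rows and columns indexed by $0,1,\dots,n$. $\mathcal S$ is the space of such matrices with inner product $A\bullet B=\operatorname{tr}(B^\top A)$, and $\mathcal S^+\subset\mathcal S$ is the cone of positive semidefinite ones. The doubly nonnegative cone is $\mathcal D=\mathcal S^+\cap\mathbb R_{\ge0}^{(n+1)\times(n+1)}$ (PSD matrices with entrywise nonnegative entries). Its dual cone in $\mathcal S$ is the Minkowski sum $\mathcal D^*=\mathcal S^++\mathbb R_{\ge0}^{(n+1)\times(n+1)}$ (the second summand being understood as the symmetric entrywise nonnegative matrices). Given symmetric matrices $Q^0,\dots,Q^m\in\mathcal S$, the sparsity pattern is $$E=\{(i,j)\in\{0,\dots,n\}^2: i=0\text{ or }j=0\text{ or }i=j\text{ or }Q^k_{ij}\ne0\text{ for some }k\in\{0,\dots,m\}\}.$$ $\mathcal S(E)=\{Y\in\mathcal S: Y_{ij}=0\ \forall (i,j)\notin E\}$, and $\Pi_E:\mathcal S\to\mathcal S(E)$ is the orthogonal projection, $[\Pi_E(Y)]_{ij}=Y_{ij}$ for $(i,j)\in E$ and $0$ otherwise; $\Pi_E(\mathcal D)=\{\Pi_E(Y):Y\in\mathcal D\}$. The dual cone in $\mathcal S(E)$ of a cone $K\subseteq\mathcal S(E)$ is $\{C\in\mathcal S(E): C\bullet Z\ge0\ \forall Z\in K\}$. *)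

(* Defs.v *)
From HB Require Import structures.
From mathcomp Require Import all_boot all_order all_algebra.
From mathcomp Require Import all_classical all_reals all_analysis.

Set Implicit Arguments.
Unset Strict Implicit.
Unset Printing Implicit Defensive.

Import Order.TTheory GRing.Theory Num.Theory.

Local Open Scope classical_set_scope.
Local Open Scope ring_scope.

(* Throughout, N plays the role of n + 1: matrices are indexed by 'I_n.+1,
   that is, by 0, ..., n. *)

Definition mxdot (R : realType) (N : nat) (A B : 'M[R]_N) : R := \tr (B^T *m A).

Definition symm (R : realType) (N : nat) : set 'M[R]_N :=
  [set A | A \is symmetricmx].

Definition psd (R : realType) (N : nat) : set 'M[R]_N :=
  [set A | symm A /\ forall x : 'cV[R]_N, 0 <= (x^T *m A *m x) 0 0].

Definition nonneg (R : realType) (N : nat) : set 'M[R]_N :=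
  [set A | symm A /\ forall i j, 0 <= A i j].

Definition dnn (R : realType) (N : nat) : set 'M[R]_N := @psd R N `&` @nonneg R N.

(* The explicit Minkowski-sum form of the dual of dnn in symm; it is not
   defined as [dual_cone symm dnn], so no closedness of the sum is built in. *)
Definition dnn_dual (R : realType) (N : nat) : set 'M[R]_N :=
  [set A + B | A in @psd R N & B in @nonneg R N].

Definition sparsity (R : realType) (n m : nat) (Q : 'I_m.+1 -> 'M[R]_n.+1) :
    {set 'I_n.+1 * 'I_n.+1} :=
  [set ij | [|| ij.1 == ord0, ij.2 == ord0, ij.1 == ij.2
              | [exists k, Q k ij.1 ij.2 != 0]]]%SET.

Definition symm_on (R : realType) (N : nat) (E : {set 'I_N * 'I_N}) :
    set 'M[R]_N :=
  [set Y | symm Y /\ forall i j, (i, j) \notin E -> Y i j = 0].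

Definition proj_on (R : realType) (N : nat) (E : {set 'I_N * 'I_N})
    (Y : 'M[R]_N) : 'M[R]_N :=
  \matrix_(i, j) (if (i, j) \in E then Y i j else 0).

(* V is the ambient space in which the dual of K is taken. *)
Definition dual_cone (R : realType) (N : nat) (V K : set 'M[R]_N) :
    set 'M[R]_N :=
  [set C | V C /\ forall Z, K Z -> 0 <= mxdot C Z].

(* Main.v *)
Require Import Defs.
From HB Require Import structures.
From mathcomp Require Import all_boot all_order all_algebra.
From mathcomp Require Import all_classical all_reals all_analysis.
From mathcomp Require Import ring lra.

Set Implicit Arguments.
Unset Strict Implicit.
Unset Printing Implicit Defensive.

Import Order.TTheory GRing.Theory Num.Theory.
Import numFieldNormedType.Exports.

Local Open Scope classical_set_scope.
Local Open Scope ring_scope.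

(** Write D for the doubly nonnegative cone.  For C in S(E), pairing with
    proj_on E Y is the same as pairing with Y, so the dual of proj_on E D in
    S(E) consists of the C in S(E) that pair nonnegatively with D.  That these are
    the elements of psd + nonneg in S(E) is the equality D* = psd + nonneg.  Its
    inclusion from right to left rests on the self-duality of the psd cone
    ([psd_mxdot_ge0]).  For the other one ([dnn_dual_of_mxdot_ge0]), a matrix C
    outside psd + nonneg is separated from it by some W; testing W on the
    matrices x x^T and e_i e_j^T + e_j e_i^T shows that W is in D, so C does not
    pair nonnegatively with D.  The dual of psd + nonneg in S(E) is found in the
    same way: a matrix Z of S(E) outside proj_on E D is separated from it by
    some W in S(E), and W is in psd + nonneg by the first half
    ([dual_cone_dnn_dual]).

    Strict separation needs the cones psd + nonneg and proj_on E D to be closed,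
    which is not automatic, since both are linear images of closed cones.  Both
    images are controlled by one estimate: the entries of a psd matrix are
    bounded by its diagonal ([psd_norm_le]), and the diagonal is controlled by
    the image, since nonneg matrices only increase it and E contains it.  Hence
    |v| <= c |T v| on the cone P being mapped by T.  Under this hypothesis,
    v |-> |T v - Z|^2 attains its minimum on P, say at p, and T p - Z is the
    separating matrix ([cone_image_separation]). *)

(** * The trace inner product *)

Lemma mxdotE (R : realType) (N : nat) (A B : 'M[R]_N) :
  mxdot A B = \sum_i \sum_j A i j * B i j.
Proof.
rewrite /mxdot /mxtrace exchange_big; apply: eq_bigr => i _; rewrite mxE.
by apply: eq_bigr => j _; rewrite mxE mulrC.
Qed.

Lemma mxdotC (R : realType) (N : nat) (A B : 'M[R]_N) : mxdot A B = mxdot B A.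
Proof. by rewrite /mxdot -mxtrace_tr trmx_mul trmxK. Qed.

Lemma mxdotDl (R : realType) (N : nat) (A B C : 'M[R]_N) :
  mxdot (A + B) C = mxdot A C + mxdot B C.
Proof. by rewrite /mxdot mulmxDr mxtraceD. Qed.

Lemma mxdotZl (R : realType) (N : nat) (a : R) (A B : 'M[R]_N) :
  mxdot (a *: A) B = a * mxdot A B.
Proof. by rewrite /mxdot -scalemxAr mxtraceZ. Qed.

Lemma mxdotDr (R : realType) (N : nat) (A B C : 'M[R]_N) :
  mxdot C (A + B) = mxdot C A + mxdot C B.
Proof. by rewrite mxdotC mxdotDl !(mxdotC _ C). Qed.

Lemma mxdotZr (R : realType) (N : nat) (a : R) (A B : 'M[R]_N) :
  mxdot B (a *: A) = a * mxdot B A.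
Proof. by rewrite mxdotC mxdotZl mxdotC. Qed.

Lemma mxdot_delta (R : realType) (N : nat) (A : 'M[R]_N) i j :
  mxdot A (delta_mx i j) = A i j.
Proof.
rewrite mxdotE (bigD1 i) //= [X in _ + X]big1 => [|k ki]; last first.
  by apply: big1 => l _; rewrite mxE (negbTE ki) mulr0.
rewrite addr0 (bigD1 j) //= big1 => [|l lj]; last first.
  by rewrite mxE (negbTE lj) andbF mulr0.
by rewrite mxE !eqxx mulr1 addr0.
Qed.

(** * Symmetric and positive semidefinite matrices *)

Lemma symmE (R : realType) (N : nat) (A : 'M[R]_N) : symm A <-> A^T = A.
Proof.
rewrite /symm /= is_hermitianmxE expr0 scale1r map_mx_id //.
by split=> [/eqP <-|->].
Qed.

Lemma symmP (R : realType) (N : nat) (A : 'M[R]_N) :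
  symm A <-> forall i j, A i j = A j i.
Proof.
split=> [/symmE AT i j|Aij]; first by rewrite -[in LHS]AT mxE.
by apply/symmE/matrixP => i j; rewrite mxE.
Qed.

Lemma symmD (R : realType) (N : nat) (A B : 'M[R]_N) :
  symm A -> symm B -> symm (A + B).
Proof.
by move=> /symmE sA /symmE sB; apply/symmE; rewrite linearD /= sA sB.
Qed.

Lemma symmZ (R : realType) (N : nat) (a : R) (A : 'M[R]_N) :
  symm A -> symm (a *: A).
Proof. by move=> /symmE sA; apply/symmE; rewrite linearZ /= sA. Qed.

Lemma symm0 (R : realType) (N : nat) : symm (0 : 'M[R]_N).
Proof. by apply/symmE; rewrite trmx0. Qed.

Lemma symm_sqr (R : realType) (N : nat) (x : 'cV[R]_N) : symm (x *m x^T).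
Proof. by apply/symmE; rewrite trmx_mul trmxK. Qed.

(** Reading the quadratic form as a pairing with a rank-one matrix turns
    manipulations of it into bilinear algebra. *)
Lemma mxdot_rank1 (R : realType) (N : nat) (A : 'M[R]_N) (x y : 'cV[R]_N) :
  mxdot A (x *m y^T) = (x^T *m A *m y) 0 0.
Proof.
rewrite /mxdot trmx_mul trmxK -mulmxA mxtrace_mulC.
by rewrite mulmxA mxtrace_mulC trace_mx11.
Qed.

Lemma mxdot_sym_rank1 (R : realType) (N : nat) (A : 'M[R]_N) (x y : 'cV[R]_N) :
  symm A -> mxdot A (y *m x^T) = mxdot A (x *m y^T).
Proof.
move=> /symmE sA; rewrite /mxdot -mxtrace_tr trmx_mul trmxK sA mxtrace_mulC.
by rewrite trmx_mul trmxK.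
Qed.

Lemma psdP (R : realType) (N : nat) (A : 'M[R]_N) :
  psd A <-> symm A /\ forall x : 'cV[R]_N, 0 <= mxdot A (x *m x^T).
Proof.
by split=> -[sA Ax]; split=> // x; have := Ax x; rewrite mxdot_rank1.
Qed.

Lemma mxdot_sqrD (R : realType) (N : nat) (A : 'M[R]_N) (x y : 'cV[R]_N)
    (t : R) : symm A ->
  mxdot A ((x + t *: y) *m (x + t *: y)^T) =
  mxdot A (x *m x^T) + 2 * t * mxdot A (x *m y^T) + t ^+ 2 * mxdot A (y *m y^T).
Proof.
move=> sA; rewrite linearD linearZ /= mulmxDl !mulmxDr -!scalemxAl -!scalemxAr.
rewrite !(mxdotDr, mxdotZr) (mxdot_sym_rank1 x y sA); ring.
Qed.

Lemma mul_delta_cV (R : realType) (N : nat) (i j : 'I_N) :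
  (delta_mx i 0 : 'cV[R]_N) *m (delta_mx j 0 : 'cV[R]_N)^T = delta_mx i j.
Proof. by rewrite trmx_delta mul_delta_mx. Qed.

Lemma psd_diag_ge0 (R : realType) (N : nat) (A : 'M[R]_N) i :
  psd A -> 0 <= A i i.
Proof.
by move=> /psdP[_ /(_ (delta_mx i 0))]; rewrite mul_delta_cV mxdot_delta.
Qed.

(** Test the quadratic form on e_i + e_j and on e_i - e_j. *)
Lemma psd_entry_le (R : realType) (N : nat) (A : 'M[R]_N) i j :
  psd A -> 2 * `|A i j| <= A i i + A j j.
Proof.
move=> /psdP[sA Ax].
have key t : 0 <= A i i + 2 * t * A i j + t ^+ 2 * A j j.
  have := Ax (delta_mx i 0 + t *: delta_mx j 0).
  by rewrite mxdot_sqrD // !mul_delta_cV !mxdot_delta.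
have := key 1; have := key (-1).
rewrite sqrrN expr1n; by case: (ger0P (A i j)) => ?; lra.
Qed.

Lemma mxdot_rank1_rank1 (R : realType) (N : nat) (u x : 'cV[R]_N) :
  mxdot (u *m u^T) (x *m x^T) = (x^T *m u) 0 0 ^+ 2.
Proof.
rewrite mxdot_rank1 mulmxA -mulmxA mxE big_ord_recl big_ord0 addr0 expr2.
congr (_ * _); have -> : u^T *m x = (x^T *m u)^T by rewrite trmx_mul trmxK.
by rewrite mxE.
Qed.

(** One step of a Cholesky elimination.  Subtracting s ^ 2 / a, with
    s = x^T A e_i and a = A i i, from the form at x gives the form of A at
    x - (s / a) e_i, which is nonnegative. *)
Lemma psd_peel (R : realType) (N : nat) (A : 'M[R]_N) i :
  psd A -> A i i != 0 ->
  psd (A - (A i i)^-1 *: (col i A *m (col i A)^T)).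
Proof.
move=> psdA Aii; have [sA Ax] := (psdP A).1 psdA; apply/psdP; split.
  by rewrite -scaleNr; apply: symmD => //; apply: symmZ; exact: symm_sqr.
move=> x; rewrite -scaleNr mxdotDl mxdotZl mxdot_rank1_rank1.
set s := (_ *m _) 0 0.
have sE : mxdot A (x *m (delta_mx i 0)^T) = s.
  by rewrite mxdot_rank1 -mulmxA -colE.
have := Ax (x + (- (s / A i i)) *: delta_mx i 0).
rewrite mxdot_sqrD // sE mul_delta_cV mxdot_delta => H.
rewrite (_ : _ + _ = mxdot A (x *m x^T) + 2 * - (s / A i i) * s +
  (- (s / A i i)) ^+ 2 * A i i) //; by field.
Qed.

(** The positive semidefinite cone pairs nonnegatively with itself: by
    induction on the number of nonzero diagonal entries, A is a nonnegative
    combination of matrices u u^T, and on each of these the pairing with B is a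
    value of the quadratic form of B. *)
Lemma psd_mxdot_ge0 (R : realType) (N : nat) (A B : 'M[R]_N) :
  psd A -> psd B -> 0 <= mxdot A B.
Proof.
move=> + /psdP[_ Bx].
have [k] := ubnP #|[set i | A i i != 0]%SET|.
elim: k A => // k IHk A; rewrite ltnS => Ak psdA.
have [[i Aii]|diag0] := pselect (exists i, A i i != 0); last first.
  have A0 : A = 0.
    apply/matrixP => i j; rewrite mxE; apply/eqP; rewrite -normr_le0.
    have d0 l : A l l = 0 by apply/eqP/negP => /negP Al; apply: diag0; exists l.
    by have := psd_entry_le i j psdA; rewrite !d0; lra.
  rewrite A0 mxdotE big1 // => i _; rewrite big1 // => j _.
  by rewrite mxE mul0r.
have psdA' := psd_peel psdA Aii; set A' := (A - _) in psdA'.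
have A'E j : A' j j = A j j - A j i ^+ 2 / A i i.
  by rewrite !mxE big_ord_recl big_ord0 addr0 !mxE expr2 mulrC.
have Aipos : 0 < A i i by rewrite lt_neqAle eq_sym Aii psd_diag_ge0.
rewrite (_ : A = A' + (A i i)^-1 *: (col i A *m (col i A)^T)); last first.
  by rewrite subrK.
rewrite mxdotDl mxdotZl [X in _ * X]mxdotC.
rewrite addr_ge0 ?mulr_ge0 ?invr_ge0 ?(ltW Aipos) ?Bx //.
apply: (IHk _ _ psdA'); apply: leq_trans Ak.
apply: proper_card; apply/properP; split.
  apply/fintype.subsetP => j; rewrite !inE; apply: contraNneq => Aj0.
  rewrite eq_le (psd_diag_ge0 _ psdA') andbT A'E Aj0 sub0r oppr_le0.
  by rewrite divr_ge0 ?sqr_ge0 // ltW.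
exists i; first by rewrite inE.
by rewrite inE A'E negbK expr2 mulfK // subrr.
Qed.

(** * Topology of matrix spaces *)

Lemma mx_norm_le (R : realType) (p q : nat) (M : 'M[R]_(p, q)) (r : R) :
  `|M| <= r <-> 0 <= r /\ forall i j, `|M i j| <= r.
Proof.
rewrite /Num.norm /= mx_normrE; split.
  by move=> /bigmax_leP[r0 H]; split=> // i j; exact: (H (i, j)).
by move=> [r0 H]; apply/bigmax_leP; split=> // -[i j] _; exact: H.
Qed.

Lemma mx_entry_le (R : realType) (p q : nat) (M : 'M[R]_(p, q)) i j :
  `|M i j| <= `|M|.
Proof. by have /mx_norm_le[_] := lexx `|M|; apply. Qed.

Lemma vec_mx_continuous (R : realType) (p q : nat) :
  continuous (@vec_mx R p q).
Proof.
apply: bounded_linear_continuous.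
apply/linear_boundedP; exists 1; split=> // r r1 v.
apply/mx_norm_le; split=> [|i j].
  by rewrite mulr_ge0 // (le_trans _ (ltW r1)).
by rewrite mxE (le_trans (mx_entry_le _ _ _)) // ler_peMl // ltW.
Qed.

(** Heine-Borel for matrices, transported from row vectors along [vec_mx]. *)
Lemma mx_ball_compact (R : realType) (p q : nat) (r : R) :
  compact [set M : 'M[R]_(p, q) | `|M| <= r].
Proof.
rewrite (_ : mkset _ = vec_mx @` [set v : 'rV[R]_(p * q) | `|v| <= r]).
  apply: continuous_compact.
    by apply: continuous_subspaceT; exact: vec_mx_continuous.
  apply: bounded_closed_compact.
    exists r; split=> [|x rx v /= /le_trans -> //]; first exact: num_real.
    exact: ltW.
  apply: (@preimage_closed _ _ (fun v : 'rV[R]_(p * q) => `|v|)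
    [set x | x <= r]).
    by move=> v _; exact: norm_continuous.
  exact: closed_le.
apply/seteqP; split=> [M /= /mx_norm_le[r0 Mr]|_ /= [v /mx_norm_le[r0 vr] <-]].
  exists (mxvec M); last exact: mxvecK.
  apply/mx_norm_le; split=> // i k; case/mxvec_indexP: k => a b.
  by rewrite (ord1 i) mxvecE.
by apply/mx_norm_le; split=> // i j; rewrite mxE.
Qed.

Lemma mx_pair_ball_compact (R : realType) (p q : nat) (r : R) :
  compact [set w : 'M[R]_(p, q) * 'M[R]_(p, q) | `|w| <= r].
Proof.
rewrite (_ : mkset _ = [set M : 'M[R]_(p, q) | `|M| <= r] `*`
                       [set M : 'M[R]_(p, q) | `|M| <= r]).
  by apply: compact_setX; exact: mx_ball_compact.
by apply/seteqP; split=> -[A B]; rewrite /= prod_normE ge_max => /andP.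
Qed.

Lemma mxdot_continuous (R : realType) (N : nat) (T : topologicalType)
    (f g : T -> 'M[R]_N) :
  (forall i j, continuous (fun x => f x i j)) ->
  (forall i j, continuous (fun x => g x i j)) ->
  continuous (fun x => mxdot (f x) (g x)).
Proof.
move=> cf cg; under eq_fun do rewrite mxdotE.
apply: continuous_big => [|i _]; first exact: add_continuous.
apply: continuous_big => [|j _]; first exact: add_continuous.
by move=> x; apply: cvgM; [exact: cf|exact: cg].
Qed.

Lemma mxdot_ge0 (R : realType) (N : nat) (A : 'M[R]_N) : 0 <= mxdot A A.
Proof.
rewrite mxdotE sumr_ge0 // => i _; rewrite sumr_ge0 // => j _.
by rewrite -expr2 sqr_ge0.
Qed.

Lemma sqr_entry_le_mxdot (R : realType) (N : nat) (A : 'M[R]_N) i j :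
  A i j ^+ 2 <= mxdot A A.
Proof.
rewrite mxdotE (bigD1 i) //= (bigD1 j) //= -expr2 -addrA lerDl addr_ge0 //.
  by rewrite sumr_ge0 // => l _; rewrite -expr2 sqr_ge0.
rewrite sumr_ge0 // => k _; rewrite sumr_ge0 // => l _.
by rewrite -expr2 sqr_ge0.
Qed.

Lemma mxdot_gt0 (R : realType) (N : nat) (A : 'M[R]_N) :
  A != 0 -> 0 < mxdot A A.
Proof.
move=> A0; rewrite lt_neqAle mxdot_ge0 andbT eq_sym; apply: contraNneq A0 => AA.
apply/eqP/matrixP => i j; rewrite mxE; apply/eqP.
by rewrite -sqrf_eq0 eq_le sqr_ge0 andbT -AA sqr_entry_le_mxdot.
Qed.

(** A crude comparison of the sup norm with the squared Euclidean norm: it only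
    serves to make sublevel sets of the latter bounded. *)
Lemma norm_le_mxdot (R : realType) (N : nat) (A : 'M[R]_N) :
  `|A| <= 1 + mxdot A A.
Proof.
have A0 := mxdot_ge0 A.
apply/mx_norm_le; split=> [|i j]; first by rewrite addr_ge0.
apply: le_trans (_ : 1 + `|A i j| ^+ 2 <= _).
  by have := sqr_ge0 (`|A i j| - 1); have := normr_ge0 (A i j); nra.
by rewrite lerD2l real_normK ?num_real // sqr_entry_le_mxdot.
Qed.

(** * Separation from the image of a closed cone *)

(** The first-order optimality condition: 2 t b + t ^ 2 d is the change of a
    squared distance when moving by t away from a minimizer. *)
Lemma first_order_ge0 (R : realType) (b d : R) : 0 <= d ->
  (forall t, 0 < t <= 1 -> 0 <= 2 * t * b + t ^+ 2 * d) -> 0 <= b.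
Proof.
move=> d0 H; rewrite leNgt; apply/negP => b0.
have e0 : 0 < d - b + 1 by lra.
(* The step t = - b / (d - b + 1) makes t * d < - b. *)
have t0 : 0 < - b / (d - b + 1) by rewrite divr_gt0 // oppr_gt0.
have /H : 0 < - b / (d - b + 1) <= 1 by rewrite t0 ler_pdivrMr // mul1r; lra.
have -> : 2 * (- b / (d - b + 1)) * b + (- b / (d - b + 1)) ^+ 2 * d =
    - b / (d - b + 1) * (2 * b - b * d / (d - b + 1)).
  by field; rewrite gt_eqF.
rewrite pmulr_rge0 // leNgt => /negP; apply.
suff : - b * d / (d - b + 1) <= - b by lra.
by rewrite ler_pdivrMr //; nra.
Qed.

(** Separation of Z from T(P) by its nearest-point residual W = T p - Z.  The
    bound |v| <= c |T v| makes sublevel sets of |T v - Z|^2 in P compact, so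
    that the nearest point is attained; it replaces a proof that T(P) is closed.
    Moving p along v in P gives W . T v >= 0, and moving it towards 0 gives
    W . T p <= 0, hence W . Z <= - |W|^2.  The separating matrix is returned in
    the form T p - Z so that linear properties of Z and of the image of T pass
    to it. *)
Lemma cone_image_separation (R : realType) (N : nat) (V : normedModType R)
    (T : V -> 'M[R]_N) (P : set V) (c : R) (Z : 'M[R]_N) :
  linear T -> (forall i j, continuous (fun v => T v i j)) ->
  (forall r, compact [set v : V | `|v| <= r]) ->
  closed P -> P 0 -> (forall u v, P u -> P v -> P (u + v)) ->
  (forall a v, 0 <= a -> P v -> P (a *: v)) ->
  0 <= c -> (forall v, P v -> `|v| <= c * `|T v|) ->
  ~ (T @` P) Z ->
  exists2 p, P p &
    (forall v, P v -> 0 <= mxdot (T p - Z) (T v)) /\ mxdot (T p - Z) Z < 0.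
Proof.
move=> linT contT cptV clP P0 PD PZ c0 coer TPZ.
pose f v := mxdot (T v - Z) (T v - Z).
have contf : continuous f.
  have contTZ i j : continuous (fun v => (T v - Z) i j).
    under eq_fun do rewrite mxE.
    by move=> v; apply: cvgD; [exact: contT|exact: cvg_cst].
  exact: mxdot_continuous.
have [p Pp pmin] : exists2 p, P p & forall v, P v -> f p <= f v.
  pose r := c * (1 + f 0 + `|Z|).
  have small v : P v -> f v <= f 0 -> `|v| <= r.
    move=> Pv fv; apply: le_trans (coer _ Pv) _; rewrite ler_wpM2l //.
    rewrite -[T v](subrK Z) (le_trans (ler_normD _ _)) // lerD2r.
    by rewrite (le_trans (norm_le_mxdot _)) // lerD2l.
  have A0 : (P `&` [set v | `|v| <= r]) 0 by split=> //; exact: small.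
  have cptA : compact (P `&` [set v | `|v| <= r]).
    rewrite setIC; exact: compact_closedI.
  have [p] :=
    compact_EVT_min (ex_intro _ _ A0) cptA (continuous_subspaceT contf).
  rewrite inE => -[Pp _] pmin; exists p => // v Pv.
  have [fv|fv] := lerP (f v) (f 0).
    by apply: pmin; rewrite inE; split=> //; exact: small.
  by apply: le_trans (ltW fv); apply: pmin; rewrite inE.
exists p => //; move: (erefl (T p - Z)); move: {-1}(T p - Z) => W WE.
have variation u :
    (forall t, 0 < t <= 1 -> P (p + t *: u)) -> 0 <= mxdot W (T u).
  move=> Pu; apply: (first_order_ge0 (mxdot_ge0 (T u))) => t t01.
  have := pmin _ (Pu t t01); rewrite /f (addrC p) linT -addrA WE.
  rewrite !(mxdotDl, mxdotDr, mxdotZl, mxdotZr) (mxdotC (T u) W); lra.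
have WT v : P v -> 0 <= mxdot W (T v).
  move=> Pv; apply: variation => t /andP[t0 _].
  by apply: PD => //; apply: PZ => //; exact: ltW.
split=> //.
have WW : 0 < mxdot W W.
  apply: mxdot_gt0; rewrite -WE subr_eq0.
  by apply: contra_notN TPZ => /eqP <-; exists p.
have : 0 <= mxdot W (T (- p)).
  apply: variation => t /andP[t0 t1].
  rewrite scalerN -[p in p - _]scale1r -scalerBl.
  by apply: PZ => //; rewrite subr_ge0.
have T0 : T 0 = 0.
  by have := linT (-1) 0 0; rewrite scaler0 addr0 scaleN1r addNr.
rewrite -[- p]addr0 -scaleN1r linT T0 addr0 mxdotZr.
have -> : T p = W + Z by rewrite -WE subrK.
rewrite mxdotDr; lra.
Qed.

(** * The cones are closed *)

Lemma closed_forall_ge0 (R : realType) (T : topologicalType) (I : Type)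
    (F : I -> T -> R) :
  (forall i, continuous (F i)) -> closed [set x | forall i, 0 <= F i x].
Proof.
move=> cF; rewrite (_ : mkset _ = \bigcap_i (F i @^-1` [set y | 0 <= y])).
  apply: closed_bigI => i _; apply: preimage_closed; last exact: closed_ge.
  by move=> x _; exact: cF.
by apply/seteqP; split=> x /= H i => [_|]; exact: H.
Qed.

Lemma symm_closed (R : realType) (N : nat) : closed (@symm R N).
Proof.
rewrite (_ : @symm R N =
    [set A | forall ij : 'I_N * 'I_N, 0 <= A ij.1 ij.2 - A ij.2 ij.1]).
  apply: closed_forall_ge0 => -[i j] A.
  by apply: continuousB; exact: coord_continuous.
apply/seteqP; split=> [A /symmP sA [i j]|A /= H]; first by rewrite /= sA subrr.
apply/symmP => i j; apply: le_anti.
by have := H (i, j); have := H (j, i); rewrite /= !subr_ge0 => -> ->.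
Qed.

Lemma psd_closed (R : realType) (N : nat) : closed (@psd R N).
Proof.
rewrite (_ : @psd R N =
    @symm R N `&` [set A | forall x : 'cV[R]_N, 0 <= mxdot A (x *m x^T)]).
  apply: closedI; first exact: symm_closed.
  apply: closed_forall_ge0 => x; apply: mxdot_continuous => i j.
    exact: coord_continuous.
  exact: cst_continuous.
by apply/seteqP; split=> A /psdP.
Qed.

Lemma nonneg_closed (R : realType) (N : nat) : closed (@nonneg R N).
Proof.
rewrite (_ : @nonneg R N =
    @symm R N `&` [set A | forall ij : 'I_N * 'I_N, 0 <= A ij.1 ij.2]).
  apply: closedI; first exact: symm_closed.
  by apply: closed_forall_ge0 => -[i j]; exact: coord_continuous.
apply/seteqP; split=> A [sA A0]; split=> // i j.
exact: (A0 (i, j)).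
Qed.

(** * Cone operations and test elements *)

Lemma psd0 (R : realType) (N : nat) : psd (0 : 'M[R]_N).
Proof.
by split=> [|x]; [exact: symm0|rewrite mulmx0 mul0mx mxE].
Qed.

Lemma psdD (R : realType) (N : nat) (A B : 'M[R]_N) :
  psd A -> psd B -> psd (A + B).
Proof.
move=> [sA Ax] [sB Bx]; split=> [|x]; first exact: symmD.
by rewrite mulmxDr mulmxDl mxE addr_ge0.
Qed.

Lemma psdZ (R : realType) (N : nat) (a : R) (A : 'M[R]_N) :
  0 <= a -> psd A -> psd (a *: A).
Proof.
move=> a0 [sA Ax]; split=> [|x]; first exact: symmZ.
by rewrite -scalemxAr -scalemxAl mxE mulr_ge0.
Qed.

Lemma psd_sqr (R : realType) (N : nat) (x : 'cV[R]_N) : psd (x *m x^T).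
Proof.
apply/psdP; split=> [|y]; first exact: symm_sqr.
by rewrite mxdot_rank1_rank1 sqr_ge0.
Qed.

Lemma nonneg0 (R : realType) (N : nat) : nonneg (0 : 'M[R]_N).
Proof. by split=> [|i j]; [exact: symm0|rewrite mxE]. Qed.

Lemma nonnegD (R : realType) (N : nat) (A B : 'M[R]_N) :
  nonneg A -> nonneg B -> nonneg (A + B).
Proof.
move=> [sA A0] [sB B0]; split=> [|i j]; first exact: symmD.
by rewrite mxE addr_ge0.
Qed.

Lemma nonnegZ (R : realType) (N : nat) (a : R) (A : 'M[R]_N) :
  0 <= a -> nonneg A -> nonneg (a *: A).
Proof.
move=> a0 [sA A0]; split=> [|i j]; first exact: symmZ.
by rewrite mxE mulr_ge0.
Qed.

Lemma nonneg_mxdot_ge0 (R : realType) (N : nat) (A B : 'M[R]_N) :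
  nonneg A -> nonneg B -> 0 <= mxdot A B.
Proof.
move=> [_ A0] [_ B0]; rewrite mxdotE.
by apply: sumr_ge0 => i _; apply: sumr_ge0 => j _; exact: mulr_ge0.
Qed.

(** * The dual of the doubly nonnegative cone *)

(** The source of all boundedness below: only the diagonal of a positive
    semidefinite matrix has to be controlled. *)
Lemma psd_norm_le (R : realType) (N : nat) (A : 'M[R]_N) (r : R) :
  psd A -> 0 <= r -> (forall i, A i i <= r) -> `|A| <= r.
Proof.
move=> psdA r0 Ar; apply/mx_norm_le; split=> // i j.
by have := psd_entry_le i j psdA; have := Ar i; have := Ar j; lra.
Qed.

Lemma dnn_dual_mxdot_ge0 (R : realType) (N : nat) (C Y : 'M[R]_N) :
  dnn_dual C -> dnn Y -> 0 <= mxdot C Y.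
Proof.
move=> [A psdA [B nnB <-]] [psdY nnY]; rewrite mxdotDl.
by apply: addr_ge0; [exact: psd_mxdot_ge0|exact: nonneg_mxdot_ge0].
Qed.

(** Separation from the image of psd x nonneg under addition.  The sum A + B
    bounds both terms: its diagonal dominates that of A, hence A itself, hence
    B = (A + B) - A. *)
Lemma dnn_dual_of_mxdot_ge0 (R : realType) (N : nat) (C : 'M[R]_N) :
  symm C -> (forall Y, dnn Y -> 0 <= mxdot C Y) -> dnn_dual C.
Proof.
move=> sC CD; apply: contrapT => nC.
pose T (w : 'M[R]_N * 'M[R]_N) := w.1 + w.2.
pose P : set ('M[R]_N * 'M[R]_N) := [set w | psd w.1 /\ nonneg w.2].
have linT : linear T by move=> a u v; rewrite /T /= scalerDr addrACA.
have contT i j : continuous (fun w => T w i j).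
  under eq_fun do rewrite mxE.
  move=> w; apply: continuousD.
    by apply: (continuous_comp (f := fst) (g := fun A : 'M[R]_N => A i j));
      [exact: cvg_fst|exact: coord_continuous].
  by apply: (continuous_comp (f := snd) (g := fun A : 'M[R]_N => A i j));
    [exact: cvg_snd|exact: coord_continuous].
have clP : closed P.
  apply: (@closedI _ (fst @^-1` @psd R N) (snd @^-1` @nonneg R N)).
    apply: preimage_closed; last exact: psd_closed.
    by move=> w _; exact: cvg_fst.
  apply: preimage_closed; last exact: nonneg_closed.
  by move=> w _; exact: cvg_snd.
have coer w : P w -> `|w| <= 2 * `|T w|.
  case: w => A B [/= psdA [sB B0]]; rewrite /T /=.
  have An : `|A| <= `|A + B|.
    apply: psd_norm_le => // i; apply: le_trans (mx_entry_le _ i i).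
    by rewrite mxE (le_trans _ (ler_norm _)) // lerDl.
  rewrite prod_normE ge_max /=; apply/andP; split.
    by have := normr_ge0 (A + B); lra.
  by have := ler_normB (A + B) A; rewrite addrAC subrr add0r; lra.
have TPC : ~ (T @` P) C.
  by move=> [[A B] [/= psdA nnB] TC]; apply: nC; exists A => //; exists B.
have PD u v : P u -> P v -> P (u + v).
  by move=> [u1 u2] [v1 v2]; split; [exact: psdD|exact: nonnegD].
have PZ a v : 0 <= a -> P v -> P (a *: v).
  by move=> a0 [v1 v2]; split; [exact: psdZ|exact: nonnegZ].
have P0 : P 0 by split; [exact: psd0|exact: nonneg0].
have [[A B] [/= [sA _] [sB _]]] := cone_image_separation linT contT
  (@mx_pair_ball_compact R N N) clP P0 PD PZ (ler0n R 2) coer TPC.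
set W := T _ - C => -[WT WC].
have sW : symm W.
  by rewrite /W -scaleN1r; apply: symmD; [exact: symmD|exact: symmZ].
suff /CD : dnn W by rewrite mxdotC leNgt WC.
split.
  apply/psdP; split=> // x.
  by have := WT (x *m x^T, 0); rewrite /T /= addr0; apply; split;
    [exact: psd_sqr|exact: nonneg0].
split=> // i j.
have := WT (0, delta_mx i j + delta_mx j i).
rewrite /T /= add0r mxdotDr !mxdot_delta ((symmP W).1 sW j i) => H.
suff : 0 <= W i j + W i j by lra.
apply: H; split; first exact: psd0.
split=> [|k l] /=; last by rewrite !mxE addr_ge0.
by apply/symmE; rewrite linearD /= !trmx_delta addrC.
Qed.

(** * Duality within a sparsity pattern *)

Lemma symm_on_proj (R : realType) (N : nat) (E : {set 'I_N * 'I_N})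
    (Y : 'M[R]_N) :
  (forall i j, ((i, j) \in E) = ((j, i) \in E)) ->
  symm Y -> symm_on E (proj_on E Y).
Proof.
move=> symE /symmP sY; split=> [|i j /negbTE ijE]; last by rewrite mxE ijE.
by apply/symmP => i j; rewrite !mxE symE sY.
Qed.

(** The projection is self-adjoint and fixes its range. *)
Lemma mxdot_proj (R : realType) (N : nat) (E : {set 'I_N * 'I_N})
    (C Y : 'M[R]_N) :
  symm_on E C -> mxdot C (proj_on E Y) = mxdot C Y.
Proof.
move=> [_ C0]; rewrite !mxdotE; apply: eq_bigr => i _; apply: eq_bigr => j _.
by rewrite mxE; case: ifPn => // /C0 ->; rewrite !mul0r.
Qed.

Lemma dual_cone_proj_dnn (R : realType) (N : nat) (E : {set 'I_N * 'I_N}) :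
  dual_cone (symm_on E) (proj_on E @` @dnn R N) =
  @dnn_dual R N `&` symm_on E.
Proof.
apply/seteqP; split=> C.
  move=> [EC CK]; split=> //; apply: dnn_dual_of_mxdot_ge0; first by case: EC.
  by move=> Y dY; rewrite -(mxdot_proj _ EC); apply: CK; exists Y.
move=> [dC EC]; split=> // _ [Y dY <-].
by rewrite mxdot_proj //; exact: dnn_dual_mxdot_ge0.
Qed.

(** Separation from the image of dnn under the projection.  The diagonal lies
    in E, so the projection retains what bounds a doubly nonnegative matrix.
    The symmetry of E keeps projections in the ambient space. *)
Lemma dual_cone_dnn_dual (R : realType) (N : nat) (E : {set 'I_N * 'I_N}) :
  (forall i, (i, i) \in E) -> (forall i j, ((i, j) \in E) = ((j, i) \in E)) ->
  dual_cone (symm_on E) (@dnn_dual R N `&` symm_on E) =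
  proj_on E @` @dnn R N.
Proof.
move=> diagE symE; apply/seteqP; split=> Z; last first.
  move=> [Y dY <-]; split; first by apply: symm_on_proj => //; case: dY => -[].
  move=> C [dC EC]; rewrite mxdotC mxdot_proj //; exact: dnn_dual_mxdot_ge0.
move=> [EZ ZL]; apply: contrapT => nZ.
have linT : linear (@proj_on R N E).
  move=> a A B; apply/matrixP => i j; rewrite !mxE.
  by case: ifP => // _; rewrite mulr0 addr0.
have contT i j : continuous (fun Y : 'M[R]_N => proj_on E Y i j).
  under eq_fun do rewrite mxE.
  by case: ((i, j) \in E); [exact: coord_continuous|exact: cst_continuous].
have coer (Y : 'M[R]_N) : dnn Y -> `|Y| <= 1 * `|proj_on E Y|.
  move=> [psdY _]; rewrite mul1r; apply: psd_norm_le => // i.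
  apply: le_trans (mx_entry_le _ i i).
  by rewrite mxE diagE ler_norm.
have D0 : dnn (0 : 'M[R]_N) by split; [exact: psd0|exact: nonneg0].
have DD (A B : 'M[R]_N) : dnn A -> dnn B -> dnn (A + B).
  by move=> [? ?] [? ?]; split; [exact: psdD|exact: nonnegD].
have DZ a (A : 'M[R]_N) : 0 <= a -> dnn A -> dnn (a *: A).
  by move=> ? [? ?]; split; [exact: psdZ|exact: nonnegZ].
have [Y [psdY nnY]] := cone_image_separation linT contT (@mx_ball_compact R N N)
  (closedI (@psd_closed R N) (@nonneg_closed R N)) D0 DD DZ ler01 coer nZ.
set W := _ - Z => -[WT WZ].
have EW : symm_on E W.
  have [sY Y0] := symm_on_proj symE psdY.1; have [sZ Z0] := EZ.
  split; first by rewrite /W -scaleN1r; apply: symmD => //; exact: symmZ.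
  by move=> i j ijE; rewrite mxE [X in _ + X]mxE Y0 // Z0 // subr0.
have : (@dnn_dual R N `&` symm_on E) W.
  rewrite -dual_cone_proj_dnn; split=> // _ [V dV <-]; exact: WT.
by move=> /ZL; rewrite mxdotC leNgt WZ.
Qed.

Theorem lemma4 (R : realType) (n m : nat) (Q : 'I_m.+1 -> 'M[R]_n.+1)
    (Qsym : forall k, symm (Q k)) :
  let E := sparsity Q in
  let K := proj_on E @` @dnn R n.+1 in
  let L := @dnn_dual R n.+1 `&` symm_on E in
  dual_cone (symm_on E) K = L /\ dual_cone (symm_on E) L = K.
Proof.
move=> E K L; split; first exact: dual_cone_proj_dnn.
apply: dual_cone_dnn_dual => [i|i j]; first by rewrite inE /= eqxx !orbT.
have QC k : Q k j i = Q k i j by exact: (symmP (Q k)).1.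
rewrite !inE /= orbCA (eq_sym j i); congr [|| _, _, _ | _].
by apply: eq_existsb => k; rewrite QC.
Qed.
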